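(* If $X$ is an extremally disconnected Stone space, then the poset $\mathcal{CR}(X)$ of continuous relations on $X$, ordered by inclusion, is a coframe.
   Context: A Stone space is a compact Hausdorff zero-dimensional space; a space is extremally disconnected if the closure of each open set is open. A binary relation $R$ on a Stone space $X$ is continuous if $R[x]=\{y : x\mathrel{R}y\}$ is closed for each $x\in X$ and $R^{-1}[U]=\{x : x \mathrel{R} y \text{ for some } y\in U\}$ is clopen for each clopen $U\subseteq X$. $\mathcal{CR}(X)$ is the set of continuous relations on $X$, ordered by inclusion. A coframe is a complete lattice $L$ satisfying $a\vee\bigwedge S=\bigwedge\{a\vee b\mid b\in S\}$ for all $a\in L$ and $S\subseteq L$. *)

(* Defs.v *)
From HB Require Import structures.
From mathcomp Require Import all_boot all_order.
From mathcomp Require Import boolp classical_sets topology.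

Set Implicit Arguments.
Unset Strict Implicit.
Unset Printing Implicit Defensive.

Local Open Scope classical_set_scope.

(* Zero-dimensionality is the existence of a basis of clopen sets. MathComp-
   Analysis' [zero_dimensional] only says that clopen sets separate points. *)
Definition stone_space (X : topologicalType) : Prop :=
  [/\ compact [set: X], hausdorff_space X & basis (@clopen X)].

Definition extremally_disconnected (X : topologicalType) : Prop :=
  forall U : set X, open U -> open (closure U).

Definition rel_image (X : Type) (R : set (X * X)) (x : X) : set X :=
  [set y | R (x, y)].

Definition rel_preimage (X : Type) (R : set (X * X)) (U : set X) : set X :=
  [set x | exists2 y, U y & R (x, y)].

Definition continuous_relation (X : topologicalType) (R : set (X * X)) : Prop :=
  (forall x, closed (rel_image R x)) /\
  (forall U, clopen U -> clopen (rel_preimage R U)).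

Record CR (X : topologicalType) := MkCR {
  CR_rel :> set (X * X);
  _ : `[< continuous_relation CR_rel >] }.

(* The order is the one induced from [set (X * X)], i.e. inclusion. *)
HB.instance Definition _ (X : topologicalType) := [isSub for @CR_rel X].
HB.instance Definition _ (X : topologicalType) := [Choice of CR X by <:].
HB.instance Definition _ (X : topologicalType) := 
  [SubChoice_isSubPOrder of CR X by <: with set_display].

Lemma CR_continuous (X : topologicalType) (R : CR X) : continuous_relation R.
Proof. by case: R => R /= /asboolP. Qed.

Lemma CR_leP (X : topologicalType) (R S : CR X) : (R <= S)%O <-> (R `<=` S).
Proof. by rewrite -subsetEset. Qed.

Section Coframe.
Context {d : Order.disp_t} {L : porderType d}.

Definition complete_lattice : Prop :=
  forall S : set L, supremums S !=set0 /\ infimums S !=set0.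

Definition lattice_sup (cL : complete_lattice) (S : set L) : L :=
  sval (cid (cL S).1).

Definition lattice_inf (cL : complete_lattice) (S : set L) : L :=
  sval (cid (cL S).2).

Definition lattice_join (cL : complete_lattice) (a b : L) : L :=
  lattice_sup cL [set a; b].

Lemma lattice_supP cL S : supremums S (lattice_sup cL S).
Proof. exact: (svalP (cid (cL S).1)). Qed.

Lemma lattice_infP cL S : infimums S (lattice_inf cL S).
Proof. exact: (svalP (cid (cL S).2)). Qed.

End Coframe.

Arguments complete_lattice {d} L.

Definition coframe (d : Order.disp_t) (L : porderType d) : Prop :=
  exists cL : complete_lattice L, forall (a : L) (S : set L),
    lattice_join cL a (lattice_inf cL S) =
    lattice_inf cL [set lattice_join cL a b | b in S].

(* Main.v *)
(** Closure in [X * X] turns a lower semicontinuous relation [Q] (preimages of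
    clopens are open) into the least continuous relation above it: by
    compactness [(closure Q)^-1[U] = closure (Q^-1[U])], which is clopen because
    [X] is extremally disconnected. Hence suprema are closures of unions. If [R]
    and [A] are continuous then [R `\` A] is lower semicontinuous, and
    [R `<=` A `|` B] iff [closure (R `\` A) `<=` B], so joining with [A] has a
    left adjoint and therefore preserves infima. *)
Require Import Defs.
From mathcomp Require Import all_boot all_order.
From mathcomp Require Import boolp classical_sets topology.

Local Open Scope classical_set_scope.

Lemma supremums_lbound (d : Order.disp_t) (L : porderType d) (S : set L) :
  supremums (lbound S) `<=` infimums S.
Proof.
move=> m [ub least]; split; last exact: ub.
by move=> x Sx; apply: least => y; apply.
Qed.

Lemma complete_lattice_supremums (d : Order.disp_t) (L : porderType d) :
  (forall S : set L, supremums S !=set0) -> complete_lattice L.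
Proof.
move=> sup S; split; first exact: sup.
by have [m /supremums_lbound] := sup (lbound S); exists m.
Qed.

Lemma left_adjoint_join_coframe (d : Order.disp_t) (L : porderType d)
    (cL : complete_lattice L) :
  (forall a r : L, exists c, forall b,
     (r <= lattice_join cL a b)%O <-> (c <= b)%O) ->
  coframe L.
Proof.
move=> adj; exists cL => a S.
set T := [set lattice_join cL a b | b in S].
have [infT_lb infT_max] := lattice_infP cL T.
have [infS_lb infS_max] := lattice_infP cL S.
apply/Order.POrderTheory.le_anti/andP; split.
  apply: infT_max => _ [b Sb <-].
  (* Monotonicity of the join with [a] also comes from the adjunction: reflexivity transposes to
     [c <= lattice_inf cL S], hence [c <= b]. *)
  have [c cP] := adj a (lattice_join cL a (lattice_inf cL S)).
  apply/cP/(Order.POrderTheory.le_trans _ (infS_lb b Sb)).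
  by apply/cP; exact: Order.POrderTheory.lexx.
(* Each bound [lattice_inf cL T <= a \/ b] transposes to [c <= b], so [c] lies below the infimum of
   [S]. *)
have [c cP] := adj a (lattice_inf cL T).
apply/cP/infS_max => b Sb; apply/cP/infT_lb.
by exists b.
Qed.

Lemma subset_setU_setD (T : Type) (A B C : set T) :
  A `<=` B `|` C <-> A `\` B `<=` C.
Proof.
split=> sub x; first by move=> [/sub[]].
by move=> Ax; have [Bx|nBx] := pselect (B x); [left|right; exact: sub].
Qed.

Lemma closure_sub_closed (T : topologicalType) (A C : set T) :
  closed C -> (closure A `<=` C) <-> (A `<=` C).
Proof.
move=> /closure_id cC; split; first exact: (subset_trans (subset_closure (A := A))).
by rewrite [X in _ -> _ `<=` X]cC; exact: closure_subset.
Qed.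

Lemma rel_preimage_bigcup (X I : Type) (D : set I) (R : I -> set (X * X))
    (U : set X) :
  rel_preimage (\bigcup_(i in D) R i) U = \bigcup_(i in D) rel_preimage (R i) U.
Proof.
apply/seteqP; split=> x.
  by move=> [y Uy [i Di Rxy]]; exists i => //; exists y.
by move=> [i Di [y Uy Rxy]]; exists y => //; exists i.
Qed.

Lemma closed_rel_image (X : topologicalType) (R : set (X * X)) (x : X) :
  closed R -> closed (rel_image R x).
Proof.
move=> cR; rewrite (_ : rel_image R x = pair x @^-1` R) //.
by apply: preimage_closed => // y _; apply: cvg_pair; [exact: cvg_cst|].
Qed.

(** The preimage is the first projection of a closed, hence compact, subset of [X * X]; compact sets
    are closed in a Hausdorff space. *)
Lemma closed_rel_preimage (X : topologicalType) (R : set (X * X)) (U : set X) :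
  compact [set: X] -> hausdorff_space X -> closed R -> closed U ->
  closed (rel_preimage R U).
Proof.
move=> kX hX cR cU.
have -> : rel_preimage R U = fst @` (R `&` snd @^-1` U).
  apply/seteqP; split=> x.
    by move=> [y Uy Rxy]; exists (x, y).
  by move=> [[x' y] [Rxy Uy] <-]; exists y.
apply: compact_closed => //; apply: continuous_compact.
  by apply: continuous_subspaceT => p; exact: cvg_fst.
apply: (@subclosed_compact _ _ ([set: X] `*` [set: X])) => //.
  apply: closedI => //; apply: preimage_closed => // p _; exact: cvg_snd.
exact: compact_setX.
Qed.

Lemma rel_preimage_closure (X : topologicalType) (Q : set (X * X)) (U : set X) :
  compact [set: X] -> hausdorff_space X -> clopen U ->
  rel_preimage (closure Q) U = closure (rel_preimage Q U).
Proof.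
move=> kX hX [oU cU]; apply/seteqP; split.
  move=> x [y Uy Qxy] N Nx.
  (* Openness of [U] makes the box a neighbourhood of [(x, y)]; the converse inclusion uses that [U]
     is closed. *)
  have [|[x' y'] [Qxy' [/= Nx' Uy']]] := Qxy (N `*` U).
    by exists (N, U) => //; split => //; apply: open_nbhs_nbhs.
  by exists x'; split => //; exists y'.
apply: (closure_sub_closed _ _ _ _).2.
  by apply: closed_rel_preimage => //; exact: closed_closure.
by move=> x [y Uy Qxy]; exists y => //; exact: subset_closure.
Qed.

Lemma closure_continuous_relation (X : topologicalType) (Q : set (X * X)) :
  stone_space X -> extremally_disconnected X ->
  (forall U, clopen U -> open (rel_preimage Q U)) ->
  continuous_relation (closure Q).
Proof.
move=> [kX hX _] edX oQ; split=> [x|U clU].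
  by apply: closed_rel_image; exact: closed_closure.
rewrite rel_preimage_closure //; split; last exact: closed_closure.
exact/edX/oQ.
Qed.

Lemma clopen_nbhs (X : topologicalType) (x : X) (A : set X) :
  stone_space X -> nbhs x A -> exists2 U, clopen U /\ U x & U `<=` A.
Proof. by move=> [_ _ [_ /(_ x) bX]] /bX. Qed.

(** A clopen [V] around [y] fits inside the open complement of [R[x]]. Unlike [~ R (x, y)], the
    condition on [x] obtained this way is clopen, so it persists near [x]. *)
Lemma continuous_relation_separated (X : topologicalType) (R : set (X * X))
    (x y : X) :
  stone_space X -> continuous_relation R -> ~ R (x, y) ->
  exists2 V, clopen V /\ V y & ~ rel_preimage R V x.
Proof.
move=> sX [cR _] nRxy.
have /(clopen_nbhs _ _ _ sX)[V clVy VnR] : nbhs y (~` rel_image R x).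
  by apply: open_nbhs_nbhs; split => //; exact/closed_openC/cR.
by exists V => // -[z /VnR].
Qed.

Lemma continuous_relation_closed (X : topologicalType) (R : set (X * X)) :
  stone_space X -> continuous_relation R -> closed R.
Proof.
move=> sX cR [x y] Rxy; apply: contrapT => nRxy.
have [V [clV Vy] nVx] := continuous_relation_separated _ _ _ _ sX cR nRxy.
have [oV _] := clV; have [_ cRV] := cR.2 V clV.
(* This box is a neighbourhood of [(x, y)] that misses [R]. *)
have [|[x' y'] [Rxy' [/= nVx' Vy']]] := Rxy (~` rel_preimage R V `*` V).
  exists (~` rel_preimage R V, V) => //; split; apply: open_nbhs_nbhs.
    by split => //; exact: closed_openC.
  by [].
by apply: nVx'; exists y'.
Qed.

Lemma open_rel_preimageD (X : topologicalType) (R A : set (X * X)) (U : set X) :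
  stone_space X -> continuous_relation R -> continuous_relation A ->
  clopen U -> open (rel_preimage (R `\` A) U).
Proof.
move=> sX cR cA clU; rewrite openE => x [y Uy [Rxy nAxy]].
have [V [clV Vy] nVx] := continuous_relation_separated _ _ _ _ sX cA nAxy.
have clUV := clopenI clU clV.
have [oRUV _] := cR.2 _ clUV; have [_ cAV] := cA.2 _ clV.
(* Near [x], points keep an [R]-successor in [U] and [V], and have no [A]-successor in [V]; so that
   successor witnesses [R] minus [A]. *)
apply: (filterS (P := rel_preimage R (U `&` V) `&` ~` rel_preimage A V)).
  move=> x' [[y' [Uy' Vy'] Rxy'] nAx']; exists y' => //; split => // Axy'.
  by apply: nAx'; exists y'.
apply: open_nbhs_nbhs; split; first exact/openI/closed_openC.
by split => //; exists y.
Qed.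

Section ContinuousRelations.
Variable X : topologicalType.
Hypotheses (sX : stone_space X) (edX : extremally_disconnected X).

Lemma CR_closed (R : CR X) : closed R.
Proof. by apply: continuous_relation_closed => //; exact: CR_continuous. Qed.

Lemma CR_closure (Q : set (X * X)) :
  (forall U, clopen U -> open (rel_preimage Q U)) ->
  exists R : CR X, R = closure Q :> set (X * X).
Proof.
move=> /(closure_continuous_relation _ _ sX edX)/asboolP crQ.
by exists (MkCR crQ).
Qed.

Lemma CR_supremum (S : set (CR X)) :
  exists2 R, supremums S R & R = closure (\bigcup_(T in S) T) :> set (X * X).
Proof.
have [U clU|R RE] := CR_closure (\bigcup_(T in S) T).
  rewrite rel_preimage_bigcup; apply: bigcup_open => T _.
  exact: ((CR_continuous T).2 U clU).1.
exists R => //; split.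
  move=> T ST; apply/CR_leP; rewrite RE => p Tp.
  by apply: subset_closure; exists T.
(* An upper bound is closed in [X * X], so containing the union it contains the closure. *)
move=> B ubB; apply/CR_leP; rewrite RE; apply: (closure_sub_closed _ _ _ _).2.
  exact: CR_closed.
by apply: bigcup_sub => T /ubB/CR_leP.
Qed.

Lemma CR_complete : complete_lattice (CR X).
Proof.
by apply: complete_lattice_supremums => S; have [R] := CR_supremum S; exists R.
Qed.

(** Suprema are unique, so the choice made by [cL] is immaterial, and a union of two closed
    relations is already its own closure. *)
Lemma CR_joinE (cL : complete_lattice (CR X)) (A B : CR X) :
  lattice_join cL A B = A `|` B :> set (X * X).
Proof.
have [R supR RE] := CR_supremum [set A; B].
rewrite /lattice_join (is_subset1_supremums (lattice_supP cL _) supR) RE.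
rewrite bigcup_setU !bigcup_set1; symmetry; apply/closure_id/closedU;
  exact: CR_closed.
Qed.

Lemma CR_left_adjoint_join (cL : complete_lattice (CR X)) (A R : CR X) :
  exists C, forall B, (R <= lattice_join cL A B)%O <-> (C <= B)%O.
Proof.
have [U|C CE] := CR_closure (R `\` A).
  by apply: open_rel_preimageD => //; exact: CR_continuous.
exists C => B.
rewrite !CR_leP CR_joinE CE closure_sub_closed; last exact: CR_closed.
exact: subset_setU_setD.
Qed.

End ContinuousRelations.

Theorem theorem3p5 (X : topologicalType) :
  stone_space X -> extremally_disconnected X -> coframe (CR X).
Proof.
move=> sX edX; apply: (left_adjoint_join_coframe _ _ (CR_complete _ sX edX)).
exact: CR_left_adjoint_join.
Qed.
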